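(* Let $G$, $X$, $Y$ be additive groups and let $Z=X\times Y$. Suppose there exist a resolvable $(G\times X,\,G\times\{0\},\,K_1,\,1)$-DF, a resolvable $(G\times Y,\,G\times\{0\},\,K_2,\,1)$-DF, and a homogeneous $(Y,\max(K_1),1)$ difference matrix. Then there exists a resolvable $(G\times Z,\,G\times\{0\},\,K,\,1)$-DF with $K=\underline{|Y|}K_1\cup K_2$.
   Context: For a multiset $B$ in an additive group, $\Delta B=\{b-b'\}$ over ordered pairs of distinct positions; for a collection $\mathcal F$, $\Delta\mathcal F$ is the multiset union of the $\Delta B$ and its flatten is the multiset union of its members. For $H\le\Gamma$, a $(\Gamma,H,K,1)$-DF is a collection $\mathcal F$ of subsets of $\Gamma$ with multiset of sizes $K$ such that $\Delta\mathcal F$ equals $\Gamma\setminus H$ (each element once); it is resolvable if its flatten is a complete system of representatives (each exactly once) of the non-trivial left cosets of $H$ in $\Gamma$. $\underline{m}K$ is the multiset union of $m$ copies of $K$. A $(Y,k,1)$ difference matrix is a $k\times|Y|$ matrix with entries in $Y$ such that the difference of any two distinct rows is a permutation of $Y$; it is homogeneous if each row is also a permutation of $Y$. *)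

(* Defs.v *)
From mathcomp Require Import all_boot all_fingroup all_algebra.

Set Implicit Arguments.
Unset Strict Implicit.
Unset Printing Implicit Defensive.

Local Open Scope group_scope.

(* The additive groups of the source need not be abelian, so they are written  *)
(* as multiplicative finite groups: b - b' is b * b'^-1, and 0 is 1.           *)
(* Multisets and collections are sequences considered up to perm_eq.           *)

Definition mset_copies (T : Type) (m : nat) (K : seq T) : seq T :=
  flatten (nseq m K).

(* Differences over pairs of distinct positions, not of distinct values. *)
Definition delta (gT : finGroupType) (B : seq gT) : seq gT :=
  [seq tnth (in_tuple B) ij.1 * (tnth (in_tuple B) ij.2)^-1
     | ij : 'I_(size B) * 'I_(size B) in [pred ij | ij.1 != ij.2]].

Definition Delta (gT : finGroupType) (F : seq {set gT}) : seq gT :=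
  flatten [seq delta (enum B) | B : {set gT} <- F].

Definition flat (gT : finGroupType) (F : seq {set gT}) : seq gT :=
  flatten [seq enum B | B : {set gT} <- F].

Definition is_DF (gT : finGroupType) (H : {group gT}) (K : seq nat)
    (F : seq {set gT}) : bool :=
  perm_eq [seq #|B| | B : {set gT} <- F] K && perm_eq (Delta F) (enum (~: H)).

(* No entry of s lies in H, and every other left coset of H contains exactly   *)
(* one entry of s, counted with multiplicity.                                  *)
Definition nontrivial_lcoset_reps (gT : finGroupType) (H : {group gT})
    (s : seq gT) : bool :=
  perm_eq [seq x *: H | x <- s] (enum (lcosets H [set: gT] :\ gval H)).

Definition resolvable_DF (gT : finGroupType) (H : {group gT}) (K : seq nat)
    (F : seq {set gT}) : bool :=
  is_DF H K F && nontrivial_lcoset_reps H (flat F).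

Definition difference_matrix (Y : finGroupType) (k : nat)
    (M : 'M[Y]_(k, #|Y|)) : Prop :=
  forall i i' : 'I_k, i != i' ->
    perm_eq [seq M i j * (M i' j)^-1 | j : 'I_#|Y|] (enum Y).

Definition homogeneous_DM (Y : finGroupType) (k : nat)
    (M : 'M[Y]_(k, #|Y|)) : Prop :=
  difference_matrix M /\
  forall i : 'I_k, perm_eq [seq M i j | j : 'I_#|Y|] (enum Y).

(* G x {0} as a subgroup of G x X. *)
Definition left_factor (G X : finGroupType) : {group G * X} :=
  setX_group [set: G] 1.

(* Main.v *)
(** Replace each block [{(g_i, x_i)}] of the first family by the [#|Y|] blocks
    [{(g_i, (x_i, M i j))}], one per column [j] of the matrix. As [j] varies, the
    difference of rows [i] and [i'] covers [Y] once, so these blocks have each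
    difference [(g, (x, y))] with [x != 1] exactly once; since each row
    also covers [Y], their elements meet each coset [G x {(x, y)}] with [x != 1] once.
    The blocks [{(g, (1, y))}] coming from the second family supply what remains,
    namely [x = 1] and [y != 1]. *)

Require Import Defs.
From mathcomp Require Import all_boot all_fingroup all_algebra.

Set Implicit Arguments.
Unset Strict Implicit.
Unset Printing Implicit Defensive.

Local Open Scope group_scope.

(** * Multisets compared through the counts of all predicates, written as sums *)

Lemma count_sum (T : Type) (P : pred T) (s : seq T) :
  count P s = \sum_(x <- s) P x.
Proof. by elim: s => [|x s IHs] /=; rewrite ?big_nil // big_cons IHs. Qed.

Lemma count_enum (T : finType) (P : pred T) (A : {set T}) :
  count P (enum A) = \sum_(x in A) P x.
Proof. by rewrite count_sum big_enum. Qed.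

Lemma perm_codomP (I T : finType) (f : I -> T) :
  perm_eq [seq f i | i : I] (enum T) ->
  forall P : pred T, \sum_i (P (f i) : nat) = \sum_t P t.
Proof.
move=> /seq.permP fP P; have := fP P.
by rewrite !count_sum big_image !big_enum.
Qed.

Lemma count_delta (gT : finGroupType) (P : pred gT) (B : {set gT}) :
  count P (delta (enum B)) =
    \sum_(a in B) \sum_(b in B | a != b) P (a * b^-1)%g.
Proof.
rewrite count_sum big_image /=.
rewrite -(pair_big_dep xpredT (fun i j => i != j) (fun i j : 'I_(size (enum B)) =>
  P (tnth (in_tuple (enum B)) i * (tnth (in_tuple (enum B)) j)^-1)%g : nat)) /=.
rewrite -[in RHS]big_enum (big_tnth _ _ (enum B)).
apply: eq_bigr => i _.
rewrite big_mkcondr -[in RHS]big_enum (big_tnth _ _ (enum B)) big_mkcond /=.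
apply: eq_bigr => j _; congr (if ~~ _ then _ else _).
apply/eqP/eqP => [->//|]; rewrite !(tnth_nth 1) /= => /eqP.
by rewrite nth_uniq ?enum_uniq // => /eqP/val_inj.
Qed.

Lemma count_Delta (gT : finGroupType) (P : pred gT) (F : seq {set gT}) :
  count P (Delta F) =
    \sum_(B <- F) \sum_(a in B) \sum_(b in B | a != b) P (a * b^-1)%g.
Proof.
rewrite count_flatten sumnE !big_map.
by apply: eq_bigr => B _; rewrite count_delta.
Qed.

Lemma count_flat (gT : finGroupType) (P : pred gT) (F : seq {set gT}) :
  count P (flat F) = \sum_(B <- F) \sum_(a in B) P a.
Proof.
rewrite count_flatten sumnE !big_map.
by apply: eq_bigr => B _; rewrite count_enum.
Qed.

Lemma count_mset_copies (T : Type) (P : pred T) m (K : seq T) :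
  count P (mset_copies m K) = (m * count P K)%N.
Proof. by rewrite count_flatten map_nseq sumn_nseq mulnC. Qed.

Lemma big_imset2 (aT rT : finType) (f : aT -> rT) (B : {set aT})
    (h : rT -> rT -> nat) : injective f ->
  \sum_(a in f @: B) \sum_(b in f @: B | a != b) h a b =
  \sum_(a in B) \sum_(b in B | a != b) h (f a) (f b).
Proof.
move=> injf; rewrite big_imset /=; last exact: in2W.
apply: eq_bigr => a _; rewrite big_mkcondr big_imset /=; last exact: in2W.
by rewrite -big_mkcondr; apply: eq_bigl => b; rewrite (inj_eq injf).
Qed.

(** * Left cosets of [G x {1}] *)

Lemma in_left_factor (G X : finGroupType) (z : G * X) :
  (z \in left_factor G X) = (z.2 == 1).
Proof. by case: z => g x; rewrite !inE. Qed.

(* The left coset of [(g, x)] is [G x {x}], so it is determined by [x]. *)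
Lemma nontrivial_lcoset_reps_left_factor (G X : finGroupType)
    (s : seq (G * X)) :
  nontrivial_lcoset_reps (left_factor G X) s =
    perm_eq [seq z.2 | z <- s] (enum [set~ (1 : X)]).
Proof.
pose phi (x : X) : {set G * X} := setX setT [set x].
have phi_inj : injective phi.
  move=> x y /setP/(_ (1, x)); rewrite !inE /= eqxx => /esym/eqP; exact.
have cosetE (z : G * X) : z *: left_factor G X = phi z.2.
  apply/setP=> w; rewrite mem_lcoset in_left_factor !inE /=.
  by rewrite -(inj_eq (mulgI z.2)) mulKVg mulg1.
have HE : left_factor G X = phi 1 :> {set _}.
  by rewrite -[LHS]lcoset1 cosetE.
have -> : nontrivial_lcoset_reps (left_factor G X) s =
   perm_eq (map phi [seq z.2 | z <- s])
           (enum (lcosets (left_factor G X) [set: G * X] :\ gval (left_factor G X))).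
  by rewrite -map_comp; congr perm_eq; apply: eq_map => z; exact: cosetE.
set L := enum (_ :\ _).
(* Once both lists are images under the injective [phi], it can be cancelled. *)
suff /permPr-> : perm_eq L (map phi (enum [set~ (1 : X)])).
  by apply/idP/idP => [/(perm_map_inj phi_inj)|/(perm_map phi)].
apply: uniq_perm; rewrite ?map_inj_uniq ?enum_uniq // => C.
rewrite mem_enum in_setD1 HE; apply/andP/mapP => [[nC /lcosetsP[z _ CE]]|[x]].
  exists z.2; last by rewrite CE cosetE.
  by rewrite mem_enum !inE -(inj_eq phi_inj) -cosetE -CE.
rewrite mem_enum !inE => nx ->; rewrite (inj_eq phi_inj); split=> //.
by apply/lcosetsP; exists (1, x); rewrite ?inE ?cosetE.
Qed.

(** * The composed family and its counts *)

Section Composition.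

Variables (G X Y : finGroupType) (k : nat) (M : 'M[Y]_(k, #|Y|)).
Hypothesis homM : homogeneous_DM M.

(* Indexed by [nat], with value [1] below the last row: the rows used by a block
   [B] are the positions in [enum B]. *)
Definition entry (i : nat) (j : 'I_#|Y|) : Y :=
  if insub i is Some i' then M i' j else 1.

Lemma sum_entry (P : pred Y) i : i < k ->
  \sum_j (P (entry i j) : nat) = \sum_y P y.
Proof.
by move=> ik; rewrite /entry insubT /= (perm_codomP (homM.2 _)).
Qed.

Lemma sum_entry_diff (P : pred Y) i i' : i < k -> i' < k -> i != i' ->
  \sum_j (P (entry i j * (entry i' j)^-1)%g : nat) = \sum_y P y.
Proof.
by move=> ik i'k ii'; rewrite /entry !insubT /= (perm_codomP (homM.1 _ _ _)).
Qed.

(** The position in [enum B] assigns distinct rows to distinct elements of [B]. Both coordinates of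
    [b] are kept, so the map is injective whatever the matrix. *)
Definition lift_elt (B : {set G * X}) (j : 'I_#|Y|) (b : G * X) : G * (X * Y) :=
  (b.1, (b.2, entry (index b (enum B)) j)).

Definition embed_elt (b : G * Y) : G * (X * Y) := (b.1, (1, b.2)).

Definition composed_DF (F1 : seq {set G * X}) (F2 : seq {set G * Y}) :
    seq {set G * (X * Y)} :=
  [seq lift_elt B j @: B | B <- F1, j <- enum 'I_#|Y|] ++
  [seq embed_elt @: B | B : {set G * Y} <- F2].

Lemma lift_elt_inj B j : injective (lift_elt B j).
Proof. by move=> [g x] [g' x'] [-> ->]. Qed.

Lemma embed_elt_inj : injective embed_elt.
Proof. by move=> [g x] [g' x'] [-> ->]. Qed.

Lemma big_composed_DF (h : {set G * (X * Y)} -> nat) F1 F2 :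
  \sum_(B <- composed_DF F1 F2) h B =
    (\sum_(B <- F1) \sum_j h (lift_elt B j @: B) +
     \sum_(B <- F2) h (embed_elt @: B))%N.
Proof.
rewrite big_cat big_map big_allpairs_dep; congr (_ + _)%N.
by apply: eq_bigr => B _; rewrite big_enum.
Qed.

Lemma perm_card_composed_DF F1 F2 :
  perm_eq [seq #|B| | B : {set _} <- composed_DF F1 F2]
    (mset_copies #|Y| [seq #|B| | B : {set _} <- F1] ++
     [seq #|B| | B : {set _} <- F2]).
Proof.
apply/seq.permP => P; rewrite count_cat count_mset_copies !count_sum !big_map.
rewrite big_composed_DF big_distrr /=; congr (_ + _)%N; apply: eq_bigr => B _.
  rewrite (eq_bigr (fun=> P #|B| : nat)) => [|j _].
    by rewrite sum_nat_const card_ord.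
  by rewrite card_imset //; exact: lift_elt_inj.
by rewrite card_imset //; exact: embed_elt_inj.
Qed.

Lemma index_enum_lt (B : {set G * X}) b :
  #|B| <= k -> b \in B -> index b (enum B) < k.
Proof.
by move=> leBk bB; apply: leq_trans leBk; rewrite cardE index_mem mem_enum.
Qed.

(** For fixed [a != b] in a block, the lifted differences over all columns keep [a * b^-1] and add
    the difference of two distinct rows, which covers [Y] once. The size bound gives every element a
    genuine row. *)
Lemma count_Delta_composed_DF (P : pred (G * (X * Y))) F1 F2 :
  {in F1, forall B : {set _}, #|B| <= k} ->
  count P (Delta (composed_DF F1 F2)) =
    (\sum_y count (fun d => P (d.1, (d.2, y))) (Delta F1) +
     count (P \o embed_elt) (Delta F2))%N.
Proof.
move=> leF1k; rewrite !count_Delta big_composed_DF; congr (_ + _)%N.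
  rewrite (eq_bigr _ (fun y _ => count_Delta _ _)) [RHS]exchange_big /= !big_seq.
  apply: eq_bigr => B /leF1k leBk.
  rewrite (eq_bigr _ (fun j _ => big_imset2 _ _ (@lift_elt_inj B j))).
  rewrite exchange_big [RHS]exchange_big /=; apply: eq_bigr => a aB.
  rewrite exchange_big [RHS]exchange_big /=; apply: eq_bigr => b /andP[bB ab].
  rewrite -(sum_entry_diff (fun y => P (a.1 * b.1^-1, (a.2 * b.2^-1, y)))
    (index_enum_lt leBk aB) (index_enum_lt leBk bB)) //.
  (* The two rows differ because an element of [B] is recovered from its index. *)
  apply: contra_neq ab => eqi.
  by rewrite -(nth_index a (_ : a \in enum B)) ?eqi ?nth_index ?mem_enum.
apply: eq_bigr => B _; rewrite big_imset2; last exact: embed_elt_inj.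
apply: eq_bigr => a _; apply: eq_bigr => b _.
(* The [X]-coordinate of an embedded difference is [1 * 1^-1]. *)
by congr (P (_, (_, _)) : nat); rewrite /= invg1 mulg1.
Qed.

(** Here one element uses one row, so homogeneity replaces the difference property. *)
Lemma count_flat_composed_DF (P : pred (G * (X * Y))) F1 F2 :
  {in F1, forall B : {set _}, #|B| <= k} ->
  count P (flat (composed_DF F1 F2)) =
    (\sum_y count (fun b => P (b.1, (b.2, y))) (flat F1) +
     count (P \o embed_elt) (flat F2))%N.
Proof.
move=> leF1k; rewrite !count_flat big_composed_DF; congr (_ + _)%N.
  rewrite (eq_bigr _ (fun y _ => count_flat _ _)) [RHS]exchange_big /= !big_seq.
  apply: eq_bigr => B /leF1k leBk.
  under eq_bigr => j _ do rewrite (big_imset _ (in2W (@lift_elt_inj B j))).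
  rewrite exchange_big [RHS]exchange_big /=; apply: eq_bigr => a aB.
  by rewrite -(sum_entry (fun y => P (a.1, (a.2, y))) (index_enum_lt leBk aB)).
by apply: eq_bigr => B _; rewrite (big_imset _ (in2W embed_elt_inj)).
Qed.

End Composition.

(** * Splitting the non-identity elements of [X * Y], and the conclusion *)

Lemma sum_pair_neq1 (X Y : finGroupType) (h : X * Y -> nat) :
  \sum_(z | z != 1%g) h z =
    (\sum_y \sum_(x | x != 1%g) h (x, y) + \sum_(y | y != 1%g) h (1%g, y))%N.
Proof.
have -> : \sum_(z | z != 1%g) h z = \sum_x \sum_(y | (x, y) != 1%g) h (x, y).
  by rewrite pair_big_dep; apply: eq_big => -[].
(* The term [x = 1] forces [y != 1]; for any other [x], [y] is free. *)
rewrite [in RHS]exchange_big (bigD1 1%g) //= addnC; congr (_ + _)%N.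
  apply: eq_bigr => x /negPf x1; apply: eq_bigl => y.
  by rewrite xpair_eqE x1.
by apply: eq_bigl => y; rewrite xpair_eqE eqxx.
Qed.

Lemma sum_left_factorC (G X : finGroupType) (h : G * X -> nat) :
  \sum_(z in ~: left_factor G X) h z = \sum_(g : G) \sum_(x | x != 1%g) h (g, x).
Proof.
rewrite pair_big_dep; apply: eq_big => [z|[]//].
by rewrite inE in_left_factor.
Qed.

Theorem theorem4p2 (G X Y : finGroupType) (K1 K2 : seq nat) :
  (exists F1 : seq {set G * X}, resolvable_DF (left_factor G X) K1 F1) ->
  (exists F2 : seq {set G * Y}, resolvable_DF (left_factor G Y) K2 F2) ->
  (exists M : 'M[Y]_(\max_(k <- K1) k, #|Y|), homogeneous_DM M) ->
  exists F : seq {set G * (X * Y)},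
    resolvable_DF (left_factor G (X * Y)%type) (mset_copies #|Y| K1 ++ K2) F.
Proof.
move=> [F1 /andP[/andP[K1F1 DF1]]]; rewrite nontrivial_lcoset_reps_left_factor.
move=> RF1 [F2 /andP[/andP[K2F2 DF2]]].
rewrite nontrivial_lcoset_reps_left_factor => RF2 [M homM].
(* Block sizes are members of [K1], so the maximum of [K1] provides enough rows. *)
have leF1 : {in F1, forall B : {set _}, #|B| <= \max_(k <- K1) k}.
  move=> B BF1; apply: (leq_bigmax_seq (P := xpredT) #|B|) => //.
  by rewrite -(perm_mem K1F1) map_f.
exists (composed_DF M F1 F2); apply/andP; split; first (apply/andP; split).
- apply: perm_trans (perm_card_composed_DF _ _ _) _; apply: perm_cat => //.
  by apply/seq.permP => P; rewrite !count_mset_copies (seq.permP K1F1).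
- apply/seq.permP => P; rewrite (count_Delta_composed_DF homM) // (seq.permP DF2).
  under eq_bigr do rewrite (seq.permP DF1) count_enum sum_left_factorC.
  (* With the sum over [G] outermost, the two families are matched for each [g] separately. *)
  rewrite !count_enum !sum_left_factorC exchange_big -big_split.
  by apply: eq_bigr => g _; rewrite sum_pair_neq1.
rewrite nontrivial_lcoset_reps_left_factor.
(* Resolvability only sees second coordinates, so predicates on these suffice. *)
have cnt2 (T : finGroupType) (s : seq (G * T)) (P : pred T) :
    perm_eq [seq z.2 | z <- s] (enum [set~ 1]) ->
    count (fun z => P z.2) s = \sum_(t | t != 1%g) P t.
  move=> /seq.permP/(_ P); rewrite count_map count_enum => ->.
  by apply: eq_bigl => t; rewrite !inE.
apply/seq.permP => P; rewrite count_map (count_flat_composed_DF homM) //.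
under eq_bigr => y _ do rewrite (cnt2 _ _ (fun x => P (x, y)) RF1).
rewrite (cnt2 _ _ (fun y => P (1, y)) RF2) count_enum.
rewrite -(sum_pair_neq1 (fun z => P z : nat)).
by apply: eq_bigl => z; rewrite !inE.
Qed.
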